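(* Let $q$ be a power of a prime, let $x=q^n$ for some integer $n\ge 1$, and let $m\ge 1$ be an integer. Define $R_m$ by $$ \pi_q(x)=\frac{q}{q-1}\cdot\frac{x}{\log_q x}+\frac{1}{q-1}\sum_{j=1}^{m-1}\mathcal{S}_j\left(\frac{q}{q-1}\right)\cdot\frac{x}{(\log_q x)^{j+1}}+R_m . $$ Then $$ |R_m|\le \frac{11\sqrt{x}}{\log_q x}+m!\left(\frac{3^{m+3}\,x}{q(\log_q x)^{m+1}}+\frac{2^{m+1}}{\log_q x}\right). $$
   Context: Let $\mathbb{F}_q$ denote the finite field with $q$ elements. For real $x$, $\pi_q(x)$ denotes the number of monic irreducible polynomials $f\in\mathbb{F}_q[x]$ whose norm $N(f)=q^{\deg f}$ is at most $x$, i.e. with $\deg f\le \log_q x$. Here $\log_q$ is the logarithm to base $q$, so $\log_q x=n$ when $x=q^n$. For an integer $j\ge 0$, define the polynomial $$ \mathcal{S}_j(t)=\sum_{k=0}^{j}(-1)^{j-k}\,k!\,S(j,k)\,t^k, $$ where $S(j,k)$ is the Stirling number of the second kind, given by the identity $t^j=\sum_{k=0}^j k!\,S(j,k)\binom{t}{k}$. An empty sum (the case $m=1$) is $0$. *)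

(* Defs.v *)
From HB Require Import structures.
From mathcomp Require Import all_boot all_order all_algebra.

Set Implicit Arguments.
Unset Strict Implicit.
Unset Printing Implicit Defensive.

Import Order.TTheory GRing.Theory Num.Theory.
Local Open Scope ring_scope.

(* The number of partitions of a [j]-element set into [k] nonempty blocks;
   [stirling2P] is the identity that determines these numbers. *)
Definition stirling2 (j k : nat) : nat :=
  #|[set P : {set {set 'I_j}} | partition P [set: 'I_j] & #|P| == k]|.

Definition Spoly (R : nzRingType) (j : nat) : {poly R} :=
  \poly_(k < j.+1) ((-1) ^+ (j - k) * (k`! * stirling2 j k)%:R).

Lemma card_preim_partition (T U : finType) (P : {set {set T}}) :
  partition P [set: T] ->
  #|[set f : {ffun T -> U} | preim_partition f [set: T] == P]| = #|U| ^_ #|P|.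
Proof.
move=> partP; have /and3P[/eqP covP triP P0] := partP.
pose D : finType := {B : {set T} | B \in P}.
have memP (x : T) : pblock P x \in P by apply: pblock_mem; rewrite covP inE.
pose b (x : T) : D := exist _ (pblock P x) (memP x).
pose h (g : {ffun D -> U}) : {ffun T -> U} := [ffun x => g (b x)].
have D_ne (B : D) : exists x, x \in val B.
  by apply/set0Pn; apply: contra P0 => /eqP <-; exact: valP.
pose c (B : D) := xchoose (D_ne B).
have cK (B : D) : b (c B) = B.
  apply: val_inj; apply: def_pblock => //; first exact: valP.
  exact: (xchooseP (D_ne B)).
have hinj : injective h.
  move=> g1 g2 /ffunP E; apply/ffunP => B.
  by move: (E (c B)); rewrite !ffunE cK.
have -> : #|P| = #|{: D}| by rewrite card_sig.
rewrite -card_inj_ffuns -(card_imset _ hinj); apply: eq_card => f.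
rewrite inE; apply/eqP/imsetP => [kerf | [g]].
  have fE x y : (f x == f y) = (pblock P x == pblock P y).
    rewrite eq_pblock ?covP ?inE // -kerf pblock_equivalence_partition ?inE //.
    by split=> // /eqP ->.
  exists [ffun B => f (c B)].
    rewrite inE; apply/injectiveP => B1 B2; rewrite !ffunE => /eqP.
    rewrite fE => /eqP EB; rewrite -(cK B1) -(cK B2).
    exact: val_inj.
  apply/ffunP => x; rewrite !ffunE; apply/eqP; rewrite fE.
  by have /(congr1 val) := cK (b x); move=> /= ->.
rewrite inE => /injectiveP ginj ->; rewrite -[RHS](preim_partition_pblock partP).
rewrite /preim_partition /equivalence_partition.
apply: eq_imset => x; apply/setP => y; rewrite !inE !ffunE (inj_eq ginj).
by rewrite -val_eqE.
Qed.

Lemma stirling2P (j t : nat) :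
  (t ^ j = \sum_(k < j.+1) k`! * stirling2 j k * 'C(t, k))%N.
Proof.
rewrite -[j in LHS]card_ord -[t in LHS]card_ord -card_ffun -sum1_card.
rewrite (partition_big (fun f : {ffun 'I_j -> 'I_t} => preim_partition f setT)
  (fun P => partition P setT)) /=; last by move=> f _; exact: preim_partitionP.
have leP (P : {set {set 'I_j}}) : partition P setT -> (#|P| < j.+1)%N.
  move=> partP; have /and3P[_ _ P0] := partP.
  rewrite ltnS -[leqRHS]card_ord -cardsT (card_partition partP) -sum1_card.
  apply: leq_sum => B BP; rewrite card_gt0.
  by apply: contraNneq P0 => <-.
rewrite (partition_big (fun P : {set {set 'I_j}} => inord #|P| : 'I_j.+1) xpredT) //=.
apply: eq_bigr => k _.
rewrite mulnAC [(k`! * _)%N]mulnC bin_ffact mulnC -sum_nat_const.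
apply: eq_big => [P | P /andP[partP /eqP Pk]].
  rewrite inE; apply/andb_id2l => partP.
  by rewrite -val_eqE /= inordK ?leP.
rewrite -[in RHS]Pk inordK ?leP // -[t in RHS]card_ord -card_preim_partition //.
by rewrite sum1dep_card.
Qed.

From mathcomp Require Import finmap boolp classical_sets cardinality.
From mathcomp Require Import reals exp.

(* [(size f).-1] is the degree of a nonzero [f], so [#|F| ^ (size f).-1] is the
   norm N(f).  [fset_set] sends infinite sets to the empty set; this does not
   occur here, see [finite_irr_le]. *)
Definition irr_le (R : realType) (F : finFieldType) (x : R) : set {poly F} :=
  [set f : {poly F} | [/\ f \is monic, irreducible_poly f &
                          (#|F|%:R : R) ^+ (size f).-1 <= x]]%classic.
Arguments irr_le {R} F x.

Definition pi_q (R : realType) (F : finFieldType) (x : R) : nat :=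
  #|` fset_set (irr_le F x)|%fset.

Lemma finite_irr_le (R : realType) (F : finFieldType) (x : R) :
  finite_set (irr_le F x).
Proof.
have q1 : (1 < #|F|)%N by exact: card_finNzRing_gt1.
set N := (Num.truncn x).+2.
apply: (@sub_finite_set _ _ [set Poly (val v) | v in @setT (N.-tuple F)]%classic).
  move=> f [_ _ fx].
  have sf : (size f <= N)%N.
    have d : ((size f).-1%:R : R) <= x.
      by apply: le_trans fx; rewrite -natrX ler_nat ltnW // ltn_expl.
    have x0 : 0 <= x by apply: le_trans d.
    by apply: (leq_trans (leqSpred _)); rewrite ltnS ltnW // ltnS truncn_ge_nat.
  exists [tuple f`_i | i < N] => //=.
  apply/polyP => i; rewrite coef_Poly.
  have [iN|Ni] := ltnP i N; first by rewrite (nth_mktuple _ _ (Ordinal iN)).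
  have fi : (size f <= i)%N by exact: leq_trans sf Ni.
  by rewrite (nth_default _ fi) nth_default // size_map size_enum_ord.
apply: finite_image; exact: finite_finset.
Qed.

Definition log_base (R : realType) (b x : R) : R := ln x / ln b.

(* Main.v *)
(* Put z = 1/q and t = 1/(1 - z) = q/(q - 1), and let I_k be the number of monic
   irreducible polynomials of degree k.  The polynomial X^(q^k) - X is
   squarefree and its monic irreducible factors are those of degree dividing k,
   so that 0 <= q^k - k I_k <= 2 q^(k/2); summing over k <= n costs
   11 sqrt x / log_q x.
   For the main term, sum_(k <= n) q^k/k = q^n sum_(i < n) z^i/(n - i), where
   1/(n - i) is expanded as a geometric sum in i/n up to order m.  Evaluating
   t^j = sum_k k! S(j,k) C(t,k) at -(l + 1) writes (l + 1)^j as a combination of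
   the C(l + k, k), whose power series is (1 - z)^-(k+1); hence
   sum_l (l + 1)^j z^l = t S_j(t), and since (l + 1)^j <= j! C(l + j, j) every
   partial sum is at most j! t^(j+1).  This bound controls both the truncation of
   these series at i < n and the remainder of the geometric expansion. *)

Require Import Defs.
From mathcomp Require Import all_boot all_order all_algebra.
From mathcomp Require Import all_solvable all_field.
From mathcomp Require Import finmap ring lra.
From mathcomp Require Import boolp classical_sets cardinality.
From mathcomp Require Import reals exp topology normedtype sequences.
Import Order.TTheory GRing.Theory Num.Theory.
Import numFieldNormedType.Exports.
Local Open Scope ring_scope.

Set Implicit Arguments.
Unset Strict Implicit.
Unset Printing Implicit Defensive.

(** * Irreducible polynomials over a finite field *)

Lemma monic_irredp_dvd (F : fieldType) (p : {poly F}) : (1 < size p)%N ->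
  exists2 f, irreducible_poly f & (f \is monic) && (f %| p).
Proof.
have [N] := ubnP (size p); elim: N p => // N IH p lepN p1.
have [[d /and3P[d1 dp d_p]] | no_d] :=
    pselect (exists d : {poly F}, [&& (1 < size d)%N, (size d < size p)%N & d %| p]).
  have [||f irrf /andP[monf fd]] := IH d => //.
    exact: leq_trans dp _.
  by exists f => //; rewrite monf (dvdp_trans fd).
have p0 : p != 0 by rewrite -size_poly_gt0 ltnW.
have lc0 : (lead_coef p)^-1 != 0 by rewrite invr_eq0 lead_coef_eq0.
have eqp : (lead_coef p)^-1 *: p %= p by rewrite eqp_scale.
exists ((lead_coef p)^-1 *: p); last first.
  by rewrite (eqp_dvdl _ eqp) dvdpp andbT monicE lead_coefZ mulVf ?lead_coef_eq0.
split; first by rewrite size_scale.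
move=> d d1; rewrite (eqp_dvdr _ eqp) => dp; rewrite (eqp_rtrans eqp).
rewrite -dvdp_size_eqp // eqn_leq dvdp_leq //= leqNgt.
apply/negP => ltdp; apply: no_d; exists d; rewrite dp ltdp !andbT.
have d0 : d != 0 by apply: contraTneq dp => ->; rewrite dvd0p.
by rewrite ltn_neqAle eq_sym d1 size_poly_gt0.
Qed.

Lemma size_prod_monic_pred (F : fieldType) (s : seq {poly F}) :
  all (fun f => f \is monic) s ->
  (size (\prod_(f <- s) f)).-1 = (\sum_(f <- s) (size f).-1)%N.
Proof.
elim: s => [|f s IH] /=; first by rewrite !big_nil size_poly1.
move=> /andP[monf mons]; rewrite !big_cons -IH //.
have mp : \prod_(g <- s) g \is monic.
  by rewrite big_seq monic_prod // => g /(allP mons).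
rewrite size_Mmonic ?monic_neq0 //.
have := monic_neq0 monf; rewrite -size_poly_gt0.
have := monic_neq0 mp; rewrite -size_poly_gt0.
by case: (size f) => // a; case: size => // b _ _; rewrite addSn addnS.
Qed.

(** Induction on [s], cancelling its head from [p] whenever it is an irreducible factor.
    Squarefreeness prevents that factor from dividing the quotient, so the irreducible divisors left
    over lie in the tail. *)
Lemma squarefree_dvd_prod (F : fieldType) (s : seq {poly F}) (p : {poly F}) :
  p != 0 -> (forall f, irreducible_poly f -> ~~ (f ^+ 2 %| p)) ->
  (forall f, irreducible_poly f -> f \is monic -> f %| p -> f \in s) ->
  p %| \prod_(f <- s) f.
Proof.
elim: s p => [|g s IH] p p0 sqfree sub.
  rewrite big_nil dvdp1; apply/contraT => p1.
  have [|f irrf /andP[monf fp]] := @monic_irredp_dvd _ p.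
    by rewrite ltn_neqAle eq_sym p1 size_poly_gt0.
  by have := sub f irrf monf fp.
rewrite big_cons.
have [[irrg gp]|gp] := pselect (irreducible_poly g /\ g %| p); last first.
  apply/dvdp_mull/IH => // f irrf monf fp; have := sub f irrf monf fp.
  by rewrite inE => /predU1P[fg|//]; case: gp; rewrite -fg.
have [r pE] := dvdpP _ _ gp; rewrite pE mulrC dvdp_mul //.
have r0 : r != 0 by apply: contraNneq p0 => r0; rewrite pE r0 mul0r.
apply: IH => // f irrf => [|monf fr].
  by apply: contra (sqfree f irrf) => fr; rewrite pE dvdp_mulr.
have := sub f irrf monf; rewrite pE dvdp_mulr // => /(_ isT).
rewrite inE => /predU1P[fg|//].
by have /negP[] := sqfree f irrf; rewrite pE expr2 dvdp_mul // fg.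
Qed.

(** Distinct monic irreducibles are coprime, so Gauss's lemma multiplies their divisibilities. *)
Lemma prod_irredp_dvd (F : fieldType) (s : seq {poly F}) (p : {poly F}) :
  uniq s -> (forall f, f \in s -> [/\ irreducible_poly f, f \is monic & f %| p]) ->
  \prod_(f <- s) f %| p.
Proof.
elim: s => [|g s IH] /=; first by rewrite big_nil dvd1p.
move=> /andP[gs us] H; rewrite big_cons.
have [irrg mong gp] := H g (mem_head _ _).
have Hs f : f \in s -> [/\ irreducible_poly f, f \is monic & f %| p].
  by move=> fs; apply: H; rewrite inE fs orbT.
rewrite Gauss_dvdp ?gp ?IH //.
rewrite big_seq; elim/big_rec: _ => [|f r fs cop]; first exact: coprimep1.
rewrite coprimepMr cop andbT irreducible_poly_coprime //.
have [irrf monf _] := Hs f fs.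
apply/negP => gf; move/negP: gs; apply.
suff -> : g = f by [].
apply/eqP; rewrite -eqp_monic //; apply: irrf gf.
by case: irrg => + _; case: size => [|[]].
Qed.

(** The additive group of [F] is an elementary abelian p-group. This makes powers with exponent q^r
    additive and gives q = 0 in [F]. *)
Lemma pchar_nat_card (F : finFieldType) : [pchar F].-nat #|F|.
Proof.
have [p p_pr pF] := finPcharP F.
rewrite (eq_pnat _ (pcharf_eq pF)) -cardsT.
by case/and3P: (fin_ring_pchar_abelem pF).
Qed.

(** * Irreducible factors of X^(q^k) - X *)

Section Quotient.
Variable F : finFieldType.
Variable f : {poly F}.
Hypothesis fI : monic_irreducible_poly f.
Let K : finFieldType := {poly %/ f with fI}.
Let pr (p : {poly F}) : K := in_qpoly f p.

Lemma in_qpoly_eq0_dvdp (p : {poly F}) : (pr p == 0) = (f %| p).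
Proof.
apply/eqP/idP => [/val_eqP /= | fp].
  by rewrite -Pdiv.IdomainMonic.modpE ?mk_monicE // fI.
by apply/val_eqP; rewrite /= -Pdiv.IdomainMonic.modpE mk_monicE // fI.
Qed.

(** The field K = F[X]/(f) has q^d elements with d = deg f, so the q^d-th power map fixes the class
    of X, and so do its iterates. *)
Lemma irredp_dvd_Xq_subX a : f %| 'X^(#|F| ^ ((size f).-1 * a)) - 'X.
Proof.
rewrite -in_qpoly_eq0_dvdp /pr rmorphB rmorphXn /= subr_eq0.
rewrite expnM -(card_qfpoly fI); apply/eqP.
elim: a => [|a IH]; first by rewrite expn0 expr1.
by rewrite expnSr exprM IH; exact: (@expf_card K).
Qed.

(** With r = k mod d, the q^r-th power map fixes the class of X, which generates K over F, hence
    fixes all of K. For r > 0 the polynomial Y^(q^r) - Y would then have q^d roots, more than its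
    degree. *)
Lemma dvdn_degree_Xq_subX k : f %| 'X^(#|F| ^ k) - 'X -> ((size f).-1 %| k)%N.
Proof.
set q := #|F|; set d := (size f).-1.
rewrite -in_qpoly_eq0_dvdp /pr rmorphB rmorphXn /= subr_eq0 => /eqP Xk.
have q1 : (1 < q)%N by exact: card_finNzRing_gt1.
have pcK r : [pchar K].-nat (q ^ r)%N.
  by rewrite (eq_pnat _ (@pchar_qpoly _ f)) pnatX pchar_nat_card.
set x : K := in_qpoly f 'X in Xk *.
have Xr : x ^+ (q ^ (k %% d)) = x.
  rewrite -[RHS]Xk [in RHS](divn_eq k d) expnD exprM; congr (_ ^+ _).
  elim: (k %/ d)%N => [|a IH]; first by rewrite mul0n expn0 expr1.
  by rewrite mulSn expnD exprM -(card_qfpoly fI) (@expf_card K).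
(* Polynomial induction on the representative of [y]: the map is additive, multiplicative, and fixes
   both the constants and the class of X. *)
have fixK (y : K) : y ^+ (q ^ (k %% d)) = y.
  have -> : y = pr (val y).
    by apply/esym/val_inj/in_qpoly_small/size_mk_monic.
  elim/poly_ind: (val y) => [|p c IH].
    by rewrite /pr rmorph0 expr0n expn_eq0 (gtn_eqF (ltnW q1)).
  rewrite /pr rmorphD rmorphM /= (@exprDn_pchar K) // (@exprMn K) IH.
  rewrite -/x Xr; congr (_ + _).
  have -> : in_qpoly f c%:P ^+ (q ^ (k %% d)) = pr (c ^+ (q ^ (k %% d)))%:P.
    by rewrite polyC_exp /pr rmorphXn.
  congr (in_qpoly f _%:P).
  elim: (k %% d)%N => [|a IHa]; first by rewrite expn0 expr1.
  by rewrite expnSr exprM IHa expf_card.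
have d0 : (0 < d)%N by case: fI => -[]; rewrite /d; case: size => [|[]].
rewrite /dvdn; apply/contraT; rewrite -lt0n => r0.
set Q := (q ^ _)%N in fixK.
have Q1 : (1 < Q)%N by rewrite -(expn0 q) ltn_exp2l.
have szP : size ('X^Q - 'X : {poly K}) = Q.+1.
  by rewrite size_polyDl ?size_polyXn // size_polyN size_polyX.
have /max_poly_roots : 'X^Q - 'X != 0 :> {poly K}.
  by rewrite -size_poly_eq0 szP.
move=> /(_ (enum K)); rewrite szP enum_uniq -cardE (card_qfpoly fI) -/q -/d.
have -> : all (root ('X^Q - 'X : {poly K})) (enum K).
  apply/allP => y _; rewrite rootE !hornerE.
  by rewrite fixK subrr.
move=> /(_ isT isT); rewrite ltnS leq_exp2l // leqNgt.
by rewrite ltn_mod d0.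
Qed.
End Quotient.

Lemma natr_card_eq0 (F : finFieldType) : #|F|%:R = 0 :> F.
Proof.
apply/eqP/contraT; rewrite natf_neq0_pchar => F'.
have := card_finNzRing_gt1 F.
by rewrite (pnat_1 (pchar_nat_card F) F').
Qed.

(** A repeated factor divides the derivative, which is -1 because q = 0 in [F]. *)
Lemma squarefree_Xq_subX (F : finFieldType) k (f : {poly F}) : (0 < k)%N ->
  irreducible_poly f -> ~~ (f ^+ 2 %| 'X^(#|F| ^ k) - 'X).
Proof.
move=> k0 [f1 _]; apply/negP => /dvdpP[g gE].
have : ('X^(#|F| ^ k) - 'X : {poly F})^`() = - 1.
  rewrite derivB derivXn derivX -scaler_nat natrX natr_card_eq0 expr0n.
  by rewrite (gtn_eqF k0) scale0r sub0r.
have : f %| (g * f ^+ 2)^`().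
  rewrite expr2 !derivM dvdp_add //; apply: dvdp_mull; first exact: dvdp_mull.
  by rewrite dvdp_add ?dvdp_mulIl ?dvdp_mulIr.
rewrite -gE => + E; rewrite {}E dvdpNr // dvdp1 => /eqP f1'.
by rewrite f1' in f1.
Qed.

(** * Counting monic irreducible polynomials of a given degree *)

Lemma size_Xn_subX (F : fieldType) n : (1 < n)%N -> size ('X^n - 'X : {poly F}) = n.+1.
Proof. by move=> n1; rewrite size_polyDl ?size_polyXn // size_polyN size_polyX. Qed.

Definition monic_irr (F : finFieldType) (d : nat) : seq {poly F} :=
  [seq f <- [seq val p | p <- enum {poly_d.+1 F}] |
     [&& f \is monic, irreducibleb f & size f == d.+1]].

Lemma mem_monic_irr (F : finFieldType) d (f : {poly F}) : f \in monic_irr F d <->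
  [/\ f \is monic, irreducible_poly f & size f = d.+1].
Proof.
rewrite mem_filter; split.
  by move=> /andP[/and3P[monf /irreducibleP irrf /eqP sf] _].
move=> [monf /irreducibleP irrf sf]; rewrite monf irrf sf eqxx /=.
have sf' : (size f <= d.+1)%N by rewrite sf.
by apply/mapP; exists (NPoly sf'); rewrite ?mem_enum.
Qed.

Lemma monic_irr_uniq (F : finFieldType) d : uniq (monic_irr F d).
Proof. by rewrite filter_uniq // map_inj_uniq ?enum_uniq //; exact: val_inj. Qed.

Lemma sum_degree_monic_irr (F : finFieldType) d :
  (\sum_(f <- monic_irr F d) (size f).-1 = d * size (monic_irr F d))%N.
Proof.
transitivity (\sum_(f <- monic_irr F d) d)%N.
  by rewrite big_seq [RHS]big_seq; apply: eq_bigr => f /mem_monic_irr[_ _ ->].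
by rewrite big_const_seq count_predT iter_addn_0.
Qed.

(** The product of these polynomials divides X^(q^d) - X; compare degrees. *)
Lemma monic_irr_le (F : finFieldType) d : (0 < d)%N ->
  (d * size (monic_irr F d) <= #|F| ^ d)%N.
Proof.
move=> d0; rewrite -sum_degree_monic_irr -size_prod_monic_pred; last first.
  by apply/allP => f /mem_monic_irr[].
have q1 : (1 < #|F| ^ d)%N by rewrite -(expn0 #|F|) ltn_exp2l ?card_finNzRing_gt1.
have : \prod_(f <- monic_irr F d) f %| 'X^(#|F| ^ d) - 'X.
  apply: prod_irredp_dvd => [|f /mem_monic_irr[monf irrf sf]].
    exact: monic_irr_uniq.
  by split=> //; have := irredp_dvd_Xq_subX (irrf, monf) 1; rewrite sf muln1.
move=> /dvdp_leq; rewrite -size_poly_eq0 size_Xn_subX // => /(_ isT).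
by case: size.
Qed.

(** Conversely X^(q^k) - X, being squarefree, divides the product of all monic irreducibles of
    degree dividing k; compare degrees. *)
Lemma card_expn_le_sum_monic_irr (F : finFieldType) k : (0 < k)%N ->
  (#|F| ^ k <= \sum_(d <- divisors k) d * size (monic_irr F d))%N.
Proof.
move=> k0.
have q1 : (1 < #|F| ^ k)%N by rewrite -(expn0 #|F|) ltn_exp2l ?card_finNzRing_gt1.
under eq_bigr do rewrite -sum_degree_monic_irr.
have -> : (\sum_(d <- divisors k) \sum_(f <- monic_irr F d) (size f).-1 =
    \sum_(f <- flatten [seq monic_irr F d | d <- divisors k]) (size f).-1)%N.
  by rewrite big_flatten big_map.
rewrite -size_prod_monic_pred; last first.
  by apply/allP => f /flattenP[_ /mapP[d _ ->]] /mem_monic_irr[].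
set P := \prod_(_ <- _) _.
have P0 : P != 0.
  rewrite prodf_seq_neq0; apply/allP => f /flattenP[_ /mapP[d _ ->]] /mem_monic_irr[+ _ _].
  exact: monic_neq0.
have : 'X^(#|F| ^ k) - 'X %| P.
  apply: squarefree_dvd_prod => [|f irrf|f irrf monf fp].
  - by rewrite -size_poly_eq0 size_Xn_subX.
  - exact: squarefree_Xq_subX.
  apply/flattenP; exists (monic_irr F (size f).-1).
    by apply: map_f; rewrite -dvdn_divisors // (dvdn_degree_Xq_subX (irrf, monf)).
  apply/mem_monic_irr; split=> //.
  by case: irrf => + _; case: size.
move=> /dvdp_leq => /(_ P0); rewrite size_Xn_subX //.
by case: size.
Qed.

(** Isolate the divisor d = k. Every other divisor is at most k/2 and contributes at most q^d, and
    the geometric sum of these is at most twice its last term. *)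
Lemma monic_irr_ge (F : finFieldType) k : (0 < k)%N ->
  (#|F| ^ k <= k * size (monic_irr F k) + 2 * #|F| ^ k./2)%N.
Proof.
move=> k0; set q := #|F|.
have q1 : (1 < q)%N by exact: card_finNzRing_gt1.
apply: leq_trans (card_expn_le_sum_monic_irr F k0) _.
have -> : (\sum_(d <- divisors k) d * size (monic_irr F d) =
    \sum_(1 <= d < k.+1 | d %| k) d * size (monic_irr F d))%N.
  rewrite -[RHS]big_filter; apply: perm_big; apply: uniq_perm.
  - exact: divisors_uniq.
  - by rewrite filter_uniq // iota_uniq.
  move=> d; rewrite -dvdn_divisors // mem_filter mem_index_iota ltnS.
  by case: (boolP (d %| k)%N) => //= dk; rewrite (dvdn_gt0 k0 dk) dvdn_leq.
rewrite big_mkcond big_nat_recr //= dvdnn addnC leq_add2l.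
have hk : (k./2.+1 <= k)%N by rewrite -divn2 ltn_Pdiv.
rewrite (@big_cat_nat _ _ _ k./2.+1) //= [X in (_ + X)%N]big_nat_cond.
rewrite [X in (_ + X)%N]big1 ?addn0; last first.
  (* Write k = c d. The range k/2 < d < k excludes c = 0 and c = 1, while c >= 2 forces d <= k/2. *)
  move=> d /andP[/andP[hd dk] _]; case: ifP => // /dvdnP[c kE].
  move: hd dk; rewrite kE; case: c {kE} => [|[|c]]; rewrite ?mul0n ?mul1n ?ltnn //.
  have : (d <= (c.+2 * d)./2)%N by rewrite -divn2 leq_divRL // mulnC leq_mul2r orbT.
  by rewrite leqNgt => /negPf ->.
have geo N : (\sum_(1 <= d < N.+1) q ^ d <= 2 * q ^ N)%N.
  elim: N => [|N IH]; first by rewrite big_geq.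
  rewrite big_nat_recr //= mul2n -addnn leq_add2r (leq_trans IH) //.
  by rewrite expnS leq_mul2r q1 orbT.
apply: leq_trans (geo _); rewrite !big_nat; apply: leq_sum => d /andP[d0 _].
by case: ifP => // _; exact: monic_irr_le.
Qed.

Lemma pi_qE (R : realType) (F : finFieldType) n :
  pi_q F (#|F|%:R ^+ n : R) = (\sum_(1 <= k < n.+1) size (monic_irr F k))%N.
Proof.
have q1 : (1 < #|F|)%N by exact: card_finNzRing_gt1.
pose s := flatten [seq monic_irr F k | k <- index_iota 1 n.+1].
have us : uniq s.
  have : uniq (index_iota 1 n.+1) by exact: iota_uniq.
  rewrite /s; elim: index_iota => //= k r IH /andP[kr ur].
  rewrite cat_uniq monic_irr_uniq IH // andbT; apply/hasPn => f.
  move=> /flattenP[_ /mapP[d dr ->] /mem_monic_irr[_ _ sf]].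
  apply/negP => /mem_monic_irr[_ _]; rewrite sf => -[dk].
  by rewrite -dk dr in kr.
transitivity (size s); last first.
  by rewrite size_flatten /shape -map_comp sumnE big_map.
rewrite /pi_q; have -> : fset_set (irr_le F (#|F|%:R ^+ n : R)) = [fset f in s]%fset.
  apply/fsetP => f; rewrite in_fset_set ?inE; last exact: finite_irr_le.
  have eqv : ((#|F|%:R : R) ^+ (size f).-1 <= #|F|%:R ^+ n) = ((size f).-1 <= n)%N.
    by rewrite ler_eXn2l // ltr1n.
  apply/idP/idP => [/set_mem /= [monf irrf]|].
    rewrite eqv => fn; apply/flattenP; exists (monic_irr F (size f).-1).
      apply: map_f; rewrite mem_index_iota ltnS fn andbT.
      by case: irrf => + _; case: size => [|[]].
    apply/mem_monic_irr; split=> //.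
    by case: irrf => + _; case: size.
  move=> /flattenP[_ /mapP[k kn ->] /mem_monic_irr[monf irrf sf]].
  rewrite mem_set //= /irr_le /=; split=> //; rewrite eqv sf /=.
  by move: kn; rewrite mem_index_iota ltnS => /andP[].
by rewrite card_fseq undup_id.
Qed.

(** * An elementary bound for the sums of s^k / k *)

Lemma sum_expn_div_le (R : realFieldType) (s : R) n : 0 <= s -> 2 <= s ^+ 2 ->
  (0 < n)%N -> \sum_(1 <= k < n.+1) s ^+ k / k%:R <= 11 / 2 * (s ^+ n / n%:R).
Proof.
(* A rational lower bound for the square root of 2, accurate enough for the chain of numerical steps
   below. *)
move=> s0 s2 n0; have {}s2 : 1414 / 1000 <= s by nra.
pose S k : R := \sum_(1 <= i < k.+1) s ^+ i / i%:R.
(* The constants below are upper bounds for the recurrence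
   a_(k+1) = 1 + a_k (k + 1) / (k s); from k = 7 on, 11/2 reproduces itself. *)
have step (a b : R) k : 1 <= b -> a * k.+2%:R <= (b - 1) * k.+1%:R * (1414 / 1000) ->
    S k.+1 <= a * (s ^+ k.+1 / k.+1%:R) -> S k.+2 <= b * (s ^+ k.+2 / k.+2%:R).
  move=> b1 ab Sa; rewrite /S big_nat_recr //= -/(S k.+1) exprS.
  set X := s ^+ k.+1 in Sa *.
  have X0 : 0 <= X / (k.+1%:R * k.+2%:R) by rewrite divr_ge0 ?exprn_ge0 ?mulr_ge0.
  have ab' : a * k.+2%:R <= (b - 1) * k.+1%:R * s.
    by apply: le_trans ab _; rewrite ler_wpM2l // mulr_ge0 // subr_ge0.
  have k1 : k.+1%:R != 0 :> R by rewrite pnatr_eq0.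
  have k2 : k.+2%:R != 0 :> R by rewrite pnatr_eq0.
  have := ler_wpM2r X0 ab'; move: Sa; clear X0 ab ab'.
  move: k.+1%:R k.+2%:R k1 k2 => k1 k2 k10 k20.
  have -> : a * k2 * (X / (k1 * k2)) = a * (X / k1) by field; rewrite k10 k20.
  have -> : (b - 1) * k1 * s * (X / (k1 * k2)) = b * (s * X / k2) - s * X / k2.
    by field; rewrite k10 k20.
  lra.
have S1 : S 1 <= 1 * (s ^+ 1 / 1%:R) by rewrite /S big_nat1 mul1r.
have S2 : S 2 <= 242 / 100 * (s ^+ 2 / 2%:R) by apply: step S1; lra.
have S3 : S 3 <= 357 / 100 * (s ^+ 3 / 3%:R) by apply: step S2; lra.
have S4 : S 4 <= 437 / 100 * (s ^+ 4 / 4%:R) by apply: step S3; lra.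
have S5 : S 5 <= 487 / 100 * (s ^+ 5 / 5%:R) by apply: step S4; lra.
have S6 : S 6 <= 514 / 100 * (s ^+ 6 / 6%:R) by apply: step S5; lra.
have S7 : S 7 <= 11 / 2 * (s ^+ 7 / 7%:R) by apply: step S6; lra.
have S8 k : S k.+4.+3 <= 11 / 2 * (s ^+ k.+4.+3 / k.+4.+3%:R).
  (* The inequality needed is 11/2 (k + 8) <= 9/2 (k + 7) 1.414; at k = 0 it reads 44 <= 44.541. *)
  elim: k => // k; apply: step; first by lra.
  have -> : k.+4.+4%:R = k%:R + 8 :> R by rewrite -natrD addnC.
  have -> : k.+4.+3%:R = k%:R + 7 :> R by rewrite -natrD addnC.
  by have := ler0n R k; lra.
have weak (a : R) k : a <= 11 / 2 -> S k <= a * (s ^+ k / k%:R) ->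
    S k <= 11 / 2 * (s ^+ k / k%:R).
  move=> a11 /le_trans; apply; apply: ler_wpM2r => //.
  by rewrite divr_ge0 ?exprn_ge0.
move: n0; case: n => // -[_|[_|[_|[_|[_|[_|n _]]]]]]; last exact: S8.
- by apply: weak S1; lra.
- by apply: weak S2; lra.
- by apply: weak S3; lra.
- by apply: weak S4; lra.
- by apply: weak S5; lra.
- by apply: weak S6; lra.
Qed.

(** * The power series of the functions (l + 1)^j *)

(** This is division of a power series by 1 - z, at the level of partial sums. L / (1 - z) is the
    fixed point of y -> L + z y, which gives the bound by induction; monotone convergence then
    provides a limit, and the recurrence identifies it. *)
Lemma series_rec_cvg (R : realType) (z L : R) (u v : nat -> R) :
  0 <= z < 1 -> 0 <= L -> u 0%N = 0 -> nondecreasing_seq u ->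
  (forall N, u N.+1 = v N.+1 + z * u N) ->
  (forall N, v N <= L) -> (v @ \oo --> L)%classic ->
  (forall N, u N <= L / (1 - z)) /\ (u @ \oo --> L / (1 - z))%classic.
Proof.
move=> /andP[z0 z1] L0 u0 ndu urec vL vlim.
have t0 : 1 - z != 0 by rewrite subr_eq0 eq_sym lt_eqF.
have uB N : u N <= L / (1 - z).
  elim: N => [|N IH]; first by rewrite u0 divr_ge0 // subr_ge0 ltW.
  have -> : L / (1 - z) = L + z * (L / (1 - z)) by field.
  by rewrite urec lerD // ler_wpM2l.
split=> //.
have cu : cvgn u.
  by apply: nondecreasing_is_cvgn => //; exists (L / (1 - z)) => _ [N _ <-].
have lim_rec : ((fun N => v N.+1 + z * u N) @ \oo --> L + z * limn u)%classic.
  apply: cvgD; first by rewrite (cvg_shiftS v).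
  by apply: cvgMr.
have lim_u : ((fun N => v N.+1 + z * u N) @ \oo --> limn u)%classic.
  have -> : (fun N => v N.+1 + z * u N) = (fun N => u N.+1).
    by apply/funext => N; rewrite urec.
  by rewrite (cvg_shiftS u).
have E := cvg_unique (@norm_hausdorff _ R) lim_rec lim_u.
suff -> : L / (1 - z) = limn u by [].
apply: (mulIf t0); rewrite divfK //; move: (limn u) E => l E.
by rewrite mulrBr mulr1 -{1}E [l * z]mulrC addrK.
Qed.

(** The negative binomial series, by induction on [k]: the base case is the geometric series, and
    Pascal's rule supplies the recurrence that divides by 1 - z once more. *)
Lemma bin_series_cvg (R : realType) (z : R) k : 0 <= z < 1 ->
  (forall N, \sum_(0 <= l < N) 'C(l + k, k)%:R * z ^+ l <= (1 - z)^-1 ^+ k.+1) /\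
  ((fun N => \sum_(0 <= l < N) 'C(l + k, k)%:R * z ^+ l) @ \oo -->
     (1 - z)^-1 ^+ k.+1)%classic.
Proof.
move=> z01; have /andP[z0 z1] := z01.
have t0 : 0 <= (1 - z)^-1 by rewrite invr_ge0 subr_ge0 ltW.
have nd j : nondecreasing_seq (fun N => \sum_(0 <= l < N) 'C(l + j, j)%:R * z ^+ l).
  apply/nondecreasing_seqP => N; rewrite big_nat_recr //= lerDl.
  by rewrite mulr_ge0 ?exprn_ge0.
elim: k => [|k [IHle IHlim]].
  rewrite expr1 -[(1 - z)^-1]mul1r.
  apply: (@series_rec_cvg _ _ _ _ (fun=> 1)) => //; first by rewrite big_geq.
    move=> N; rewrite big_nat_recl //= bin0 expr0 mulr1 mulr_sumr.
    by congr (_ + _); apply: eq_bigr => l _; rewrite !bin0 !mul1r exprS.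
  exact: cvg_cst.
rewrite exprSr; apply: series_rec_cvg IHle IHlim => //.
- exact: exprn_ge0.
- by rewrite big_geq.
elim=> [|N IH]; first by rewrite !big_nat1 big_geq // mulr0 addr0 !binn.
have binE : 'C(N.+1 + k.+1, k.+1) = ('C(N + k.+1, k.+1) + 'C(N.+1 + k, k))%N.
  by rewrite addSn binS addSnnS.
rewrite big_nat_recr //= {1}IH.
rewrite [\sum_(0 <= l < N.+2) _]big_nat_recr //=.
rewrite [X in _ = _ + z * X]big_nat_recr //= binE natrD exprS; ring.
Qed.

Lemma prod_rising l k : (\prod_(i < k) (l.+1 + i) = k`! * 'C(l + k, k))%N.
Proof.
elim: k => [|k IH]; first by rewrite big_ord0 fact0 bin0.
rewrite big_ord_recr /= IH -mulnA [('C(_, _) * _)%N]mulnC addSn.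
by rewrite -[X in 'C(X, k)]/((l + k).+1.-1) mul_bin_diag mulnA [(k`! * _)%N]mulnC -factS addnS.
Qed.

(** Compare factorwise with the rising product (l + 1) ... (l + j). *)
Lemma expn_le_fact_bin l j : (l.+1 ^ j <= j`! * 'C(l + j, j))%N.
Proof.
rewrite -prod_rising -[j in (_ ^ j)%N]card_ord -prod_nat_const.
by apply: leq_prod => i _; exact: leq_addr.
Qed.

Lemma prod_falling (R : nzRingType) (t k : nat) :
  \prod_(i < k) (t%:R - i%:R) = (t ^_ k)%:R :> R.
Proof.
elim: k => [|k IH]; first by rewrite big_ord0.
rewrite big_ord_recr /= IH ffactnSr natrM.
have [kt|tk] := leqP k t; first by rewrite natrB.
by rewrite ffact_small // !mul0r.
Qed.

(** Lifts [stirling2P] to polynomials so that it can be evaluated at negative points: the difference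
    of both sides vanishes at 0, 1, ..., [size P] - 1, too many roots for a nonzero polynomial. *)
Lemma polyXn_stirling2 (R : realFieldType) j :
  'X^j = \sum_(k < j.+1) (stirling2 j k)%:R *: \prod_(i < k) ('X - i%:R%:P)
  :> {poly R}.
Proof.
apply/eqP; rewrite -subr_eq0; apply/eqP.
set P := _ - _.
apply: (@roots_geq_poly_eq0 _ P [seq t%:R | t <- iota 0 (size P)]).
- apply/allP => _ /mapP[t _ ->]; rewrite rootE /P hornerD hornerN hornerXn.
  rewrite horner_sum -natrX stirling2P natr_sum subr_eq0; apply/eqP.
  apply: eq_bigr => k _; rewrite hornerZ horner_prod.
  under eq_bigr do rewrite hornerXsubC.
  by rewrite prod_falling -bin_ffact mulnAC mulnC natrM [('C(_, _) * _)%N]mulnC.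
- by rewrite map_inj_uniq ?iota_uniq // => a b /eqP; rewrite eqr_nat => /eqP.
- by rewrite size_map size_iota.
Qed.

(* [polyXn_stirling2] at the point [-(l + 1)]. *)
Lemma natrX_stirling2 (R : realFieldType) (l j : nat) :
  l.+1%:R ^+ j = \sum_(k < j.+1) (-1) ^+ (j - k) * (k`! * stirling2 j k)%:R * 'C(l + k, k)%:R :> R.
Proof.
have := congr1 (horner^~ (- l.+1%:R)) (polyXn_stirling2 R j).
rewrite /= hornerXn exprNn horner_sum => /(congr1 ( *%R ((-1) ^+ j))).
rewrite signrMK => ->.
rewrite mulr_sumr; apply: eq_bigr => k _; rewrite hornerZ horner_prod.
have kj : (k <= j)%N by rewrite -ltnS.
(* Each factor -(l + 1) - i is -1 times a factor of the rising product; the resulting (-1)^k turns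
   (-1)^j into (-1)^(j-k). *)
under eq_bigr do rewrite hornerXsubC -opprD -natrD -mulN1r.
rewrite big_split /= prodr_const card_ord -natr_prod prod_rising.
rewrite -[j in (-1) ^+ j](subnK kj) exprD -mulrA [_%:R * (_ * _)]mulrCA signrMK.
by rewrite !natrM; ring.
Qed.

Section PowerSeries.
Variables (R : realType) (z : R).
Hypothesis z01 : 0 <= z < 1.
Let t := (1 - z)^-1.

(** Partial sums of Li_(-j)(z) / z, where Li is the polylogarithm. Starting at base 1 leaves out the
    term 0^j, which matters only for j = 0. *)
Definition pow_series (j N : nat) : R := \sum_(0 <= l < N) l.+1%:R ^+ j * z ^+ l.

Lemma pow_series_le j N : pow_series j N <= j`!%:R * t ^+ j.+1.
Proof.
have [leB _] := bin_series_cvg j z01.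
apply: le_trans (ler_wpM2l (ler0n _ _) (leB N)).
rewrite mulr_sumr; apply: ler_sum => l _; rewrite mulrA ler_wpM2r //.
  by rewrite exprn_ge0 //; case/andP: z01.
by rewrite -natrX -natrM ler_nat expn_le_fact_bin.
Qed.

Lemma pow_series_cvg j : (pow_series j @ \oo --> t * (Spoly R j).[t])%classic.
Proof.
have -> : pow_series j = fun N => \sum_(k < j.+1)
    (-1) ^+ (j - k) * (k`! * stirling2 j k)%:R * \sum_(0 <= l < N) 'C(l + k, k)%:R * z ^+ l.
  apply/funext => N; under eq_bigr do rewrite mulr_sumr.
  rewrite exchange_big /=; apply: eq_bigr => l _.
  rewrite natrX_stirling2 mulr_suml; apply: eq_bigr => k _.
  by rewrite mulrA.
have -> : t * (Spoly R j).[t] = \sum_(k < j.+1)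
    (-1) ^+ (j - k) * (k`! * stirling2 j k)%:R * t ^+ k.+1.
  rewrite horner_poly mulr_sumr; apply: eq_bigr => k _.
  by rewrite exprS mulrCA.
apply: cvg_big => [|k _]; first exact: add_continuous.
by apply: cvgMr; have [] := bin_series_cvg k z01.
Qed.

Lemma pow_series_nd j : nondecreasing_seq (pow_series j).
Proof.
apply/nondecreasing_seqP => N; rewrite /pow_series big_nat_recr //= lerDl.
by rewrite mulr_ge0 ?exprn_ge0 //; case/andP: z01.
Qed.

(** The lower bound is monotonicity. For the upper one, l + p + 1 <= (p + 1)(l + 1) compares the
    tail from p with (p + 1)^j z^p times a partial sum from 0. *)
Lemma pow_series_tail j p :
  0 <= t * (Spoly R j).[t] - pow_series j p <=
    p.+1%:R ^+ j * z ^+ p * (j`!%:R * t ^+ j.+1).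
Proof.
have z0 : 0 <= z by case/andP: z01.
have wlim := @pow_series_cvg j.
have limE := cvg_lim (@norm_hausdorff _ R) wlim.
have cw : cvgn (pow_series j) by apply/cvg_ex; exists (t * (Spoly R j).[t]).
rewrite -limE subr_ge0 (nondecreasing_cvgn_le (@pow_series_nd j)) //=.
rewrite lerBlDl; apply: limr_le => //; near=> N.
have pN : (p <= N)%N by near: N; exact: nbhs_infty_ge.
rewrite /pow_series (@big_cat_nat _ _ _ p) //= lerD2l.
rewrite -{1}[p]add0n big_addn.
apply: le_trans (ler_wpM2l _ (pow_series_le j (N - p))); last first.
  by rewrite mulr_ge0 ?exprn_ge0.
rewrite mulr_sumr; apply: ler_sum => l _.
rewrite exprD mulrACA -exprMn [z ^+ l * _]mulrC.
rewrite ler_wpM2r ?mulr_ge0 ?exprn_ge0 //.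
rewrite lerXn2r ?nnegrE ?mulr_ge0 // -natrM ler_nat.
by rewrite mulSn mulnS addnA addSn leq_addr.
Unshelve. all: by end_near.
Qed.
End PowerSeries.

(** * The expansion of the sum of q^k / k *)

Lemma invr_sub_geom (R : fieldType) (a b : R) m : a != 0 -> a - b != 0 ->
  (a - b)^-1 = \sum_(0 <= j < m) b ^+ j / a ^+ j.+1 + b ^+ m / (a ^+ m * (a - b)).
Proof.
move=> a0 ab0; elim: m => [|m IH]; first by rewrite big_geq // add0r !expr0 !mul1r.
rewrite big_nat_recr //= IH -addrA; congr (_ + _).
rewrite !exprS; set A := a ^+ m; set B := b ^+ m.
have A0 : A != 0 by rewrite expf_neq0.
by field; rewrite a0 ab0 A0.
Qed.

(** Collects the truncation errors of all orders j < m into one term. *)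
Lemma sum_fact_le (R : realFieldType) m :
  \sum_(0 <= j < m) j`!%:R * 2 ^+ j.+1 <= m`!%:R * 2 ^+ m.+1 :> R.
Proof.
elim: m => [|m IH]; first by rewrite big_geq // mulr_ge0 ?exprn_ge0.
rewrite big_nat_recr //= (le_trans (lerD IH (lexx _))) // -mulr2n -[X in X <= _]mulr_natl.
rewrite [2 ^+ m.+2]exprS [_ * (2 * _)]mulrCA ler_wpM2l // ler_wpM2r ?exprn_ge0 //.
by rewrite ler_nat factS leq_pmull.
Qed.

(** The left side times m! is m! 2^(m+1) + (m+1)! 2^(m+2), the sum that arises in
    [remainder_bound]. *)
Lemma pow2_linear_le_pow3 (R : realFieldType) m : (0 < m)%N ->
  2 ^+ m.+1 * (2 * m%:R + 3) <= 3 ^+ (m + 3) :> R.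
Proof.
case: m => // m _; elim: m => [|m IH]; first by rewrite !exprS expr0; lra.
rewrite addSn [3 ^+ _]exprS [2 ^+ _]exprS.
have -> : m.+2%:R = m%:R + 2 :> R by rewrite -natrD addn2.
move: IH; have -> : m.+1%:R = m%:R + 1 :> R by rewrite natr1.
have e0 : 0 <= 2 ^+ m.+2 :> R by rewrite exprn_ge0.
have := mulr_ge0 e0 (ler0n R m).
by move: (2 ^+ m.+2) (3 ^+ _) (m%:R) e0 => E T M; lra.
Qed.

Section Expansion.
Variables (R : realType) (q : R) (n m : nat).
Hypotheses (q2 : 2 <= q) (n0 : (0 < n)%N) (m0 : (0 < m)%N).
Let z := q^-1.
Let t := (1 - z)^-1.

Let q0 : q != 0. Proof. by apply: lt0r_neq0; have := q2; lra. Qed.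
Let q10 : q - 1 != 0. Proof. by apply: lt0r_neq0; have := q2; lra. Qed.
Let z01 : 0 <= z < 1.
Proof.
have qp : 0 < q by exact: lt_le_trans q2.
by rewrite /z invr_ge0 ltW //= invf_lt1 // (lt_le_trans _ q2) // ltr1n.
Qed.
Let z0 : 0 <= z. Proof. by case/andP: z01. Qed.
Let tE : t = q / (q - 1).
Proof. by rewrite /t /z; field; rewrite q10 q0. Qed.
Let ztE : z * t = (q - 1)^-1.
Proof. by rewrite tE /z; field; rewrite q10 q0. Qed.
Let t0 : 0 <= t. Proof. by rewrite invr_ge0 subr_ge0 ltW //; case/andP: z01. Qed.
Let t2 : t <= 2.
Proof. by have h := q2; rewrite tE ler_pdivrMr; lra. Qed.
Let nR0 : n%:R != 0 :> R. Proof. by rewrite pnatr_eq0 -lt0n. Qed.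

Lemma sum_expn_div_rev :
  \sum_(1 <= k < n.+1) q ^+ k / k%:R =
  \sum_(0 <= i < n) q ^+ n * z ^+ i * (n%:R - i%:R)^-1.
Proof.
rewrite big_add1 big_nat_rev /= add0n !big_nat; apply: eq_bigr => i /andP[_ iltn].
rewrite subnSK // natrB ?(ltnW iltn) //; congr (_ / _).
by rewrite /z exprVn expfB_cond // (negPf q0) ltnW.
Qed.

(** Apply [invr_sub_geom] with a = n and b = i, then exchange the sums: q^n / n^(j+1) gets the
    coefficient sum_(i < n) i^j z^i. *)
Lemma sum_expn_div_split :
  \sum_(1 <= k < n.+1) q ^+ k / k%:R =
  \sum_(0 <= j < m) q ^+ n / n%:R ^+ j.+1 * ((j == 0%N)%:R + z * pow_series z j n.-1)
  + q ^+ n / n%:R ^+ m * \sum_(0 <= i < n) z ^+ i * (i%:R ^+ m / (n%:R - i%:R)).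
Proof.
(* The term i = 0 is 0^j, with 0^0 = 1; the others are reindexed by i = l + 1, which brings out one
   factor z. *)
have head j : (j == 0%N)%:R + z * pow_series z j n.-1 = \sum_(0 <= i < n) i%:R ^+ j * z ^+ i.
  rewrite -{2}(prednK n0) big_nat_recl //= expr0n expr0 mulr1; congr (_ + _).
  by rewrite /pow_series mulr_sumr; apply: eq_bigr => i _; rewrite exprS mulrCA.
under [in RHS]eq_bigr do rewrite head mulr_sumr.
rewrite exchange_big /= mulr_sumr -big_split /= sum_expn_div_rev !big_nat.
apply: eq_bigr => i /andP[_ iltn].
have ni0 : n%:R - i%:R != 0 :> R by rewrite subr_eq0 eqr_nat gtn_eqF.
rewrite {1}(invr_sub_geom m nR0 ni0) mulrDr mulr_sumr; congr (_ + _).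
  by apply: eq_bigr => j _; ring.
by rewrite invfM; ring.
Qed.

(** For 0 <= i < n, (n - i)(1 + i) >= n, so 1/(n - i) <= (1 + i)/n. This leaves power series of
    orders m and m + 1, bounded using t <= 2; the term i = 0 vanishes, and the factor z of the
    remaining ones yields the 1/q. *)
Lemma remainder_bound :
  0 <= \sum_(0 <= i < n) z ^+ i * (i%:R ^+ m / (n%:R - i%:R))
    <= m`!%:R * (3 ^+ (m + 3) / (q * n%:R)).
Proof.
have ni i : (i < n)%N -> 0 < n%:R - i%:R :> R by rewrite subr_gt0 ltr_nat.
apply/andP; split.
  rewrite big_nat; apply: sumr_ge0 => i /andP[_ iltn].
  by rewrite mulr_ge0 ?exprn_ge0 ?divr_ge0 ?exprn_ge0 // ltW ?ni.
have bnd : \sum_(0 <= i < n) z ^+ i * (i%:R ^+ m / (n%:R - i%:R)) <=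
    n%:R^-1 * (z * (pow_series z m n.-1 + pow_series z m.+1 n.-1)).
  rewrite -{1}(prednK n0) big_nat_recl //= expr0n gtn_eqF // mul0r mulr0 add0r.
  rewrite /pow_series -big_split /= !mulr_sumr !big_nat; apply: ler_sum => i /andP[_ ip].
  have i1n : (i.+1 < n)%N by rewrite -(prednK n0).
  rewrite exprS.
  have -> : n%:R^-1 * (z * (i.+1%:R ^+ m * z ^+ i + i.+1%:R ^+ m.+1 * z ^+ i)) =
    z * z ^+ i * (i.+1%:R ^+ m * ((1 + i.+1%:R) / n%:R)) by rewrite exprS; ring.
  apply: ler_wpM2l; first by rewrite mulr_ge0 ?exprn_ge0.
  apply: ler_wpM2l; first by rewrite exprn_ge0.
  rewrite -[X in X <= _]mul1r ler_pdivrMr ?ni // mulrAC ler_pdivlMr ?ltr0n // mul1r.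
  rewrite -natrB ?(ltnW i1n) // nat1r -natrM ler_nat.
  by rewrite mulSn -{1}(subnK (ltnW i1n)) leq_add2l leq_pmulr // subn_gt0.
apply: le_trans bnd _.
have lek k : k`!%:R * t ^+ k.+1 <= k`!%:R * 2 ^+ k.+1.
  by rewrite ler_wpM2l // lerXn2r ?nnegrE.
have W1 := le_trans (pow_series_le z01 m n.-1) (lek m).
have W2 := le_trans (pow_series_le z01 m.+1 n.-1) (lek m.+1).
have -> : m`!%:R * (3 ^+ (m + 3) / (q * n%:R)) = n%:R^-1 * (z * (m`!%:R * 3 ^+ (m + 3))).
  by rewrite invfM /z; ring.
apply: ler_wpM2l; first by rewrite invr_ge0.
apply: ler_wpM2l => //; apply: le_trans (lerD W1 W2) _.
apply: le_trans (ler_wpM2l (ler0n _ _) (pow2_linear_le_pow3 R m0)).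
rewrite factS natrM [2 ^+ m.+2]exprS -[m.+1%:R]natr1 le_eqVlt; apply/orP; left.
by apply/eqP; ring.
Qed.

(** Use [pow_series_tail] at p = n - 1: there (p + 1)^j cancels n^(j+1) down to 1/n, and z z^(n-1)
    cancels q^n. *)
Lemma tail_bound :
  0 <= \sum_(0 <= j < m) q ^+ n / n%:R ^+ j.+1 *
         (z * (t * (Spoly R j).[t] - pow_series z j n.-1))
    <= m`!%:R * (2 ^+ m.+1 / n%:R).
Proof.
have tail j := pow_series_tail z01 j n.-1.
have qn0 : 0 <= q ^+ n by rewrite exprn_ge0 // (le_trans _ q2).
apply/andP; split.
  apply: sumr_ge0 => j _; apply: mulr_ge0; first by rewrite divr_ge0 // exprn_ge0.
  by apply: mulr_ge0 => //; case/andP: (tail j).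
rewrite mulrA; apply: le_trans (ler_wpM2r _ (sum_fact_le R m)); last by rewrite invr_ge0.
rewrite mulr_suml; apply: ler_sum => j _.
have /andP[_ tailj] := tail j.
apply: (@le_trans _ _ (q ^+ n / n%:R ^+ j.+1 *
    (z * (n%:R ^+ j * z ^+ n.-1 * (j`!%:R * t ^+ j.+1))))).
  rewrite ler_wpM2l //; first by rewrite divr_ge0 // exprn_ge0.
  rewrite ler_wpM2l //.
  by move: tailj; rewrite prednK.
have zn : z ^+ n = z * z ^+ n.-1 by rewrite -exprS prednK.
have qz : q ^+ n * z ^+ n = 1 by rewrite -exprMn /z mulfV ?expr1n.
have -> : q ^+ n / n%:R ^+ j.+1 * (z * (n%:R ^+ j * z ^+ n.-1 * (j`!%:R * t ^+ j.+1))) =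
    (q ^+ n * z ^+ n) * (n%:R ^+ j / n%:R ^+ j.+1) * (j`!%:R * t ^+ j.+1).
  by rewrite zn; ring.
have -> : n%:R ^+ j / n%:R ^+ j.+1 = n%:R^-1 :> R.
  by rewrite exprS invfM mulrCA mulfV ?mulr1 // expf_neq0.
rewrite qz mul1r mulrC ler_wpM2r ?invr_ge0 // ler_wpM2l //.
by rewrite lerXn2r ?nnegrE.
Qed.

Lemma sum_expn_div_expansion :
  `|\sum_(1 <= k < n.+1) q ^+ k / k%:R
    - (q / (q - 1) * (q ^+ n / n%:R)
       + (q - 1)^-1 * \sum_(1 <= j < m)
           (Spoly R j).[q / (q - 1)] * (q ^+ n / n%:R ^+ j.+1))|
  <= m`!%:R * (3 ^+ (m + 3) * q ^+ n / (q * n%:R ^+ m.+1) + 2 ^+ m.+1 / n%:R).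
Proof.
have S0 : (Spoly R 0).[t] = 1.
  have /esym := stirling2P 0 0.
  rewrite /Spoly horner_poly !big_ord_recl !big_ord0 /= bin0 muln1 addn0 => ->.
  by rewrite !expr0 !mulr1 addr0.
(* Since z t = 1/(q - 1), these are the coefficients of [sum_expn_div_split] with each partial sum
   replaced by its limit; for j = 0 this is 1 + 1/(q - 1) = q/(q - 1). *)
have -> : q / (q - 1) * (q ^+ n / n%:R) + (q - 1)^-1 * \sum_(1 <= j < m)
    (Spoly R j).[q / (q - 1)] * (q ^+ n / n%:R ^+ j.+1) =
    \sum_(0 <= j < m) q ^+ n / n%:R ^+ j.+1 *
      ((j == 0%N)%:R + z * (t * (Spoly R j).[t])).
  rewrite [RHS]big_ltn // S0 mulr1 ztE expr1 mulr_sumr; congr (_ + _).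
    rewrite [LHS]mulrC eqxx mulr1n; congr (_ * _).
    by apply: (mulIf q10); rewrite divfK // mulrDl mul1r mulVf // subrK.
  rewrite !big_nat; apply: eq_bigr => -[//|j] _.
  by rewrite add0r -tE [z * _]mulrA ztE; ring.
have /andP[T0 Tle] := tail_bound; have /andP[M0 Mle] := remainder_bound.
rewrite sum_expn_div_split addrAC -sumrB.
rewrite (_ : \sum_(0 <= j < m) _ = - \sum_(0 <= j < m) q ^+ n / n%:R ^+ j.+1 *
    (z * (t * (Spoly R j).[t] - pow_series z j n.-1))); last first.
  by rewrite -sumrN; apply: eq_bigr => j _; ring.
rewrite addrC.
set T := \sum_(0 <= j < m) _ in T0 Tle *.
have qn0 : 0 <= q ^+ n / n%:R ^+ m.
  by rewrite divr_ge0 ?exprn_ge0 // (le_trans _ q2).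
apply: le_trans (ler_normB _ _) _.
rewrite (ger0_norm T0) (ger0_norm (mulr_ge0 qn0 M0)) mulrDr lerD //.
apply: le_trans (ler_wpM2l qn0 Mle) _; rewrite exprS !invfM le_eqVlt; apply/orP; left.
by apply/eqP; ring.
Qed.
End Expansion.

(** * Comparison of [pi_q] with the sum of q^k / k, and conclusion *)

Lemma pi_q_sub_sum_le (R : realType) (F : finFieldType) n (q : R) :
  q = #|F|%:R -> (0 < n)%N ->
  `|(pi_q F (q ^+ n))%:R - \sum_(1 <= k < n.+1) q ^+ k / k%:R|
    <= 11 * Num.sqrt (q ^+ n) / n%:R.
Proof.
move=> hq n0.
have q2 : 2 <= q by rewrite hq ler_nat card_finNzRing_gt1.
have q0 : 0 <= q by exact: le_trans q2.
set s := Num.sqrt q; have ss : s ^+ 2 = q by rewrite sqr_sqrtr.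
have s0 : 0 <= s by exact: sqrtr_ge0.
have s1 : 1 <= s by rewrite -(@expr_ge1 _ 2) // ss (le_trans _ q2) // ler1n.
have -> : Num.sqrt (q ^+ n) = s ^+ n.
  by rewrite -[q in LHS]ss -exprM mulnC exprM sqrtr_sqr ger0_norm ?exprn_ge0.
rewrite {1}hq pi_qE distrC natr_sum -sumrB.
have term k : (0 < k)%N ->
    0 <= q ^+ k / k%:R - (size (monic_irr F k))%:R <= 2 * (s ^+ k / k%:R).
  move=> k0; have kR : 0 < k%:R :> R by rewrite ltr0n.
  rewrite subr_ge0 ler_pdivlMr // mulrC lerBlDr mulrA ler_pdivrMr //.
  rewrite mulrDl divfK ?gt_eqF // [_ * k%:R]mulrC -natrM hq -natrX ler_nat monic_irr_le //=.
  apply: (@le_trans _ _ (k * size (monic_irr F k) + 2 * #|F| ^ k./2)%:R).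
    by rewrite ler_nat monic_irr_ge.
  rewrite natrD natrM [X in X <= _]addrC natrM natrX -hq lerD2r // ler_wpM2l //.
  (* q^(k./2) <= s^k, as s^k is q^(k./2) times s^0 or s^1, and s >= 1. *)
  rewrite -[k in _ <= s ^+ k]odd_double_half exprD -mul2n exprM ss ler_peMl ?exprn_ge0 //.
  by rewrite exprn_ege1.
rewrite ger0_norm; last first.
  by rewrite big_nat; apply: sumr_ge0 => k /andP[k0 _]; case/andP: (term k k0).
apply: (@le_trans _ _ (2 * \sum_(1 <= k < n.+1) s ^+ k / k%:R)).
  rewrite mulr_sumr !big_nat; apply: ler_sum => k /andP[k0 _].
  by case/andP: (term k k0).
have := @sum_expn_div_le _ s n s0; rewrite ss => /(_ q2 n0); lra.
Qed.

Theorem theorem1 (R : realType) (F : finFieldType) (n m : nat)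
    (hn : (1 <= n)%N) (hm : (1 <= m)%N) (q x Rm : R)
    (hq : q = #|F|%:R) (hx : x = q ^+ n)
    (hRm : (pi_q F x)%:R =
       q / (q - 1) * (x / log_base q x)
       + (q - 1)^-1 *
         (\sum_(1 <= j < m)
            (Spoly R j).[q / (q - 1)] * (x / (log_base q x) ^+ j.+1))
       + Rm) :
  `|Rm| <= 11 * Num.sqrt x / log_base q x
           + (m`!)%:R * (3 ^+ (m + 3) * x / (q * (log_base q x) ^+ m.+1)
                         + 2 ^+ m.+1 / log_base q x).
Proof.
have q2 : 2 <= q by rewrite hq ler_nat card_finNzRing_gt1.
have logE : log_base q x = n%:R.
  have lq : ln q != 0 by rewrite gt_eqF // ln_gt0 // (lt_le_trans _ q2) // ltr1n.
  by rewrite /log_base hx lnXn ?(lt_le_trans _ q2) // -[ln q *+ n]mulr_natl mulfK.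
move: hRm; rewrite logE hx => /(canLR (addKr _)) <-.
(* Inserting the sum of q^k / k splits the error into the prime-counting part and the expansion
   part. *)
rewrite addrC -(subrKA (\sum_(1 <= k < n.+1) q ^+ k / k%:R)).
apply: le_trans (ler_normD _ _) (lerD _ _); first exact: pi_q_sub_sum_le.
exact: sum_expn_div_expansion.
Qed.
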